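(* Let $G=(V,E)$ be a finite undirected tree and let $w_k:E\to(0,\infty)$, $k\in\mathbb{N}$, be a sequence of edge weight functions. Write $G_k=(V,E,w_k)$ for $G$ equipped with $w_k$. For each $k\in\mathbb{N}$ let $q_k>0$, and assume that for each edge $e\in E$ the limit $\lim_{k\to\infty}\frac{w_k(e)}{q_k}$ exists in $[0,\infty]$. Let $x,y\in V$ be adjacent. Then as $k\to\infty$, $$U_{q_k}^{(G_k)}(x,y)\to\begin{cases}0&\text{if }q_k=o(w_k(x,y))\\1&\text{if }q_k=\omega(w_k(x,y)).\end{cases}$$
   Context: An undirected weighted graph is considered as a directed graph in which each undirected edge gives two directed edges (one per orientation) of the same weight. A rooted spanning forest of a finite directed graph $G$ is a subset $F$ of its directed edges such that each vertex has at most one outgoing edge in $F$ and $F$ contains no directed cycle; its roots are the vertices without outgoing edge in $F$ and $r(F)$ is the number of roots. For $q>0$, the random rooted spanning forest $\Phi_q$ of $G$ has law $\mathbb{P}(\Phi_q=F)=q^{r(F)}w(F)/Z_G(q)$, where $w(F)=\prod_{e\in F}w(e)$ and $Z_G(q)=\sum_Fq^{r(F)}w(F)$ (sum over rooted spanning forests). $U_q^{(G)}(x,y)$ is the probability that $x$ and $y$ belong to different trees (connected components, ignoring orientation) of $\Phi_q$. Notation: $a_k=\omega(b_k)$ means $b_k=o(a_k)$. *)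

(* Defs.v *)
From mathcomp Require Import all_boot all_order all_algebra.
From mathcomp Require Import all_classical all_reals all_analysis.

Set Implicit Arguments.
Unset Strict Implicit.
Unset Printing Implicit Defensive.

Import Order.TTheory GRing.Theory Num.Theory.
Import numFieldNormedType.Exports.

Local Open Scope ring_scope.

(* A finite simple undirected graph on V is given by its set E of edges, an
   edge being a two-element subset of V; weights are functions on these
   subsets, of which only the values on E matter. A directed graph is given by
   its set D of pairs (tail, head). *)
Section Graphs.
Variable V : finType.
Implicit Types (E : {set {set V}}) (F D : {set V * V}).

Definition edge (u v : V) : {set V} := [set u; v].

Definition simple_graph E : Prop := forall e, e \in E -> #|e| = 2%N.

Definition adj E : rel V := fun u v => edge u v \in E.

(* The bound 2 discards the degenerate closed walks u, v, u along one edge. *)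
Definition acyclic_graph E : Prop :=
  forall c : seq V, uniq c -> cycle (adj E) c -> (size c <= 2)%N.

Definition connected_graph E : Prop :=
  (0 < #|V|)%N /\ forall u v : V, connect (adj E) u v.

Definition tree E : Prop :=
  [/\ simple_graph E, connected_graph E & acyclic_graph E].

Definition orientations E : {set V * V} := [set a | edge a.1 a.2 \in E].

Definition arc_rel F : rel V := fun u v => (u, v) \in F.

(* Loops and pairs of opposite arcs do count as directed cycles. *)
Definition no_directed_cycle F : Prop :=
  forall c : seq V, uniq c -> cycle (arc_rel F) c -> c = [::].

Definition rooted_spanning_forest D F : Prop :=
  [/\ F \subset D, forall u : V, (#|[set v | arc_rel F u v]| <= 1)%N
    & no_directed_cycle F].

Definition forests D : {set {set V * V}} :=
  [set F | `[< rooted_spanning_forest D F >]].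

Definition forest_roots F : {set V} := [set u | [forall v, ~~ arc_rel F u v]].

Definition same_tree F : rel V :=
  connect (fun u v => arc_rel F u v || arc_rel F v u).

End Graphs.

Section RandomForest.
Variables (R : realType) (V : finType).
Implicit Types (D F : {set V * V}) (w : V * V -> R) (q : R).

Definition forest_weight w F : R := \prod_(a in F) w a.

Definition forest_Z D w q : R :=
  \sum_(F in forests D) q ^+ #|forest_roots F| * forest_weight w F.

Definition forest_law D w q F : R :=
  if F \in forests D
  then q ^+ #|forest_roots F| * forest_weight w F / forest_Z D w q else 0.

Definition forest_prob D w q (A : pred {set V * V}) : R :=
  \sum_(F : {set V * V} | A F) forest_law D w q F.

Definition diff_tree_prob D w q (x y : V) : R :=
  forest_prob D w q (fun F => ~~ same_tree F x y).

Definition arc_weight (w : {set V} -> R) : V * V -> R :=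
  fun a => w (edge a.1 a.2).

Definition U (E : {set {set V}}) (w : {set V} -> R) q (x y : V) : R :=
  diff_tree_prob (orientations E) (arc_weight w) q x y.

End RandomForest.

(* Main.v *)
Require Import Defs.
From mathcomp Require Import all_boot all_order all_algebra.
From mathcomp Require Import all_classical all_reals all_analysis.
From mathcomp Require Import ring.
Import Order.TTheory GRing.Theory Num.Theory.
Import numFieldNormedType.Exports.

(** Write [t F] for the unnormalised weight [q ^ r(F) * w(F)] and [e] for the
edge [{x, y}]. In a tree the only way to connect [x] and [y] is through [e], so
[x] and [y] lie in the same tree of [F] exactly when [F] contains one of the two
orientations of [e] ([same_tree_arc]).

Adding an arc [(x, y)] to a forest in which [x] is a root costs a root and gains
a factor [w e], so it multiplies [t] by [w e / q] ([gibbs_weight_add]). Hence: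
- deleting [e] from a forest that contains it gives a forest whose weight is
  [q / w e] times as large;
- a forest in which [x] and [y] are separated can be rerooted so that [x] becomes
  a root, by reversing the path from [x] to its root. This does not change [t],
  as both orientations of an edge have the same weight ([reroot]). Then [(x, y)]
  can be added, which gives a forest of weight [w e / q] times as large.

Neither operation is injective, but there is only a fixed number [C] of sets of
arcs and no forest has weight above the partition function. So an event on which
every forest can be turned into a forest of weight [b / a] times as large has
probability at most [C * a / b] ([forest_prob_le]). This gives
[U <= C * (q / w e)] and [1 - U <= C * (w e / q)], and both limits follow. *)

Local Open Scope ring_scope.

(** * Gibbs weights and crude bounds on probabilities *)

Section GibbsWeight.
Context {R : realType} {V : finType}.
Variables (D : {set V * V}) (w : V * V -> R) (q : R).
Hypotheses (w_gt0 : forall a, a \in D -> 0 < w a) (q_gt0 : 0 < q).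
Implicit Types (F : {set V * V}) (A : pred {set V * V}).

Definition gibbs_weight F : R := q ^+ #|forest_roots F| * forest_weight w F.

Lemma forestsP F : reflect (rooted_spanning_forest D F) (F \in forests D).
Proof. by rewrite inE; exact: asboolP. Qed.

Lemma gibbs_weight_gt0 F : F \in forests D -> 0 < gibbs_weight F.
Proof.
move=> /forestsP[/fintype.subsetP FD _ _].
by rewrite mulr_gt0 ?exprn_gt0// prodr_gt0// => a /FD; exact: w_gt0.
Qed.

Lemma gibbs_weight_le_Z F : F \in forests D -> gibbs_weight F <= forest_Z D w q.
Proof.
move=> FD; rewrite /forest_Z (bigD1 F)//= lerDl sumr_ge0// => F' /andP[F'D _].
exact/ltW/gibbs_weight_gt0.
Qed.

Lemma forests0 : finset.set0 \in forests D.
Proof.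
apply/forestsP; split; first exact: finset.sub0set.
- by move=> u; rewrite eq_card0// => v; rewrite !inE /arc_rel inE.
- case=> [//|u c] _ /=; case: c => [|v c]/= /andP[]; by rewrite /arc_rel inE.
Qed.

Lemma forest_Z_gt0 : 0 < forest_Z D w q.
Proof.
exact: lt_le_trans (gibbs_weight_gt0 _ forests0) (gibbs_weight_le_Z _ forests0).
Qed.

Lemma forest_lawE F : forest_law D w q F =
  if F \in forests D then gibbs_weight F / forest_Z D w q else 0.
Proof. by []. Qed.

Lemma forest_prob_ge0 A : 0 <= forest_prob D w q A.
Proof.
apply: sumr_ge0 => F _; rewrite forest_lawE; case: ifP => // FD.
by rewrite divr_ge0// ltW// ?gibbs_weight_gt0 ?forest_Z_gt0.
Qed.

Lemma forest_probC A :
  forest_prob D w q (fun F => ~~ A F) = 1 - forest_prob D w q A.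
Proof.
have sum1 : \sum_F forest_law D w q F = 1.
  by rewrite -big_mkcond /= -mulr_suml divff// gt_eqF// forest_Z_gt0.
by rewrite -sum1 (bigID A) /= addrAC subrr add0r.
Qed.

(** The forests [F'] need not be distinct: the sum over [A] has at most as many
terms as there are sets of arcs, and each [F'] weighs at most the partition
function. *)
Lemma forest_prob_le A (a b : R) : 0 < a -> 0 < b ->
  (forall F, F \in forests D -> A F ->
     exists2 F', F' \in forests D & gibbs_weight F * b = gibbs_weight F' * a) ->
  forest_prob D w q A * b <= #|{set V * V}|%:R * a.
Proof.
move=> a0 b0 HA.
rewrite /forest_prob mulr_suml -sum1_card natr_sum mulr_suml.
rewrite [leLHS]big_mkcond /=; apply: ler_sum => F _; rewrite mul1r.
case: ifP => [AF|_]; last exact: ltW.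
rewrite forest_lawE; case: ifPn => [FD|_]; last by rewrite mul0r ltW.
have [F' F'D eqF] := HA F FD AF.
rewrite mulrAC eqF mulrAC ger_pMl// ler_pdivrMr ?forest_Z_gt0// mul1r.
exact: gibbs_weight_le_Z.
Qed.

Lemma gibbs_weight_add F (x y : V) : x \in forest_roots F ->
  gibbs_weight ((x, y) |: F) * q = gibbs_weight F * w (x, y).
Proof.
move=> xF; have xyF : (x, y) \notin F by move: xF; rewrite inE => /forallP/(_ y).
rewrite /gibbs_weight /forest_weight big_setU1//= (cardsD1 x (forest_roots F)) xF.
suff -> : forest_roots ((x, y) |: F) = forest_roots F :\ x.
  by rewrite add1n exprS; ring.
apply/finset.setP => u; rewrite !inE; apply/forallP/andP => [H|[ux /forallP H] v].
  split; first by apply/eqP => ux; have := H y; rewrite /arc_rel !inE ux eqxx.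
  by apply/forallP => v; have := H v; rewrite /arc_rel !inE negb_or => /andP[].
by rewrite /arc_rel !inE negb_or xpair_eqE negb_and ux; exact: H.
Qed.

End GibbsWeight.

(** * Rooted forests of a tree *)

Section TreeForests.
Context {V : finType} {E : {set {set V}}}.
Hypothesis treeE : tree E.
Implicit Types (F : {set V * V}).

Local Notation forestsE := (forests (orientations E)).

Lemma edgeC (u v : V) : edge u v = edge v u.
Proof. exact: finset.setUC. Qed.

Lemma adjC (u v : V) : adj E u v = adj E v u.
Proof. by rewrite /adj edgeC. Qed.

Lemma adj_irrefl (u : V) : adj E u u = false.
Proof.
apply/negP => uu; have [/(_ _ uu) + _ _] := treeE.
by rewrite /edge finset.setUid cards1.
Qed.

Lemma adj_neq (u v : V) : adj E u v -> u != v.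
Proof. by apply: contraTneq => ->; rewrite adj_irrefl. Qed.

Lemma forest_adj F (u v : V) : F \in forestsE -> (u, v) \in F -> adj E u v.
Proof. by move=> /forestsP[/fintype.subsetP FD _ _] /FD; rewrite inE. Qed.

Lemma forest_asym F (u v : V) : F \in forestsE ->
  (u, v) \in F -> (v, u) \notin F.
Proof.
move=> FE uv; apply/negP => vu; have /forestsP[_ _ acF] := FE.
suff : [:: u; v] = [::] by [].
apply: acF; first by rewrite /= inE (adj_neq _ _ (forest_adj _ _ _ FE uv)).
by rewrite /= /arc_rel uv vu.
Qed.

Lemma forest_del F a : F \in forestsE -> F :\ a \in forestsE.
Proof.
move=> /forestsP[FD outF acF]; apply/forestsP; split.
- exact: fintype.subset_trans (subD1set _ _) FD.
- move=> u; apply: leq_trans (outF u); apply/subset_leq_card/fintype.subsetP => v.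
  by rewrite !inE /arc_rel inE => /andP[].
- move=> c uc cc; apply: acF uc _; apply: sub_cycle cc => u v.
  by rewrite /arc_rel inE => /andP[].
Qed.

Lemma forest_del_root F (u v : V) : F \in forestsE -> (u, v) \in F ->
  u \in forest_roots (F :\ (u, v)).
Proof.
move=> /forestsP[_ outF _] uvF; rewrite inE; apply/forallP => z.
rewrite /arc_rel !inE xpair_eqE eqxx /=; apply/negP => /andP[zv uzF].
have := outF u; rewrite leqNgt => /negP; apply.
by apply/card_gt1P; exists z, v; split => //; rewrite inE.
Qed.

(** Since the only possible cycles in a tree are the back-and-forth walks along
one edge, adding an arc creates a directed cycle only if its reverse is already
present. *)
Lemma forest_add F (x y : V) : F \in forestsE -> x \in forest_roots F ->
  adj E x y -> (y, x) \notin F -> (x, y) |: F \in forestsE.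
Proof.
move=> FE xF xy yxF; have /forestsP[FD outF acF] := FE.
have FD' : (x, y) |: F \subset orientations E.
  by rewrite finset.subUset FD andbT finset.sub1set inE.
apply/forestsP; split => //.
- move=> u; have [->|ux] := eqVneq u x.
    rewrite -(cards1 y); apply/subset_leq_card/fintype.subsetP => v.
    rewrite !inE /arc_rel !inE xpair_eqE eqxx /= => /orP[//|xvF].
    by move: xF; rewrite inE => /forallP/(_ v); rewrite /arc_rel xvF.
  apply: leq_trans (outF u); apply/subset_leq_card/fintype.subsetP => v.
  by rewrite !inE /arc_rel !inE xpair_eqE (negPf ux).
- move=> c uc cc; have [_ _ acE] := treeE.
  have subE : subrel (arc_rel ((x, y) |: F)) (adj E).
    by move=> u v uv; have := fintype.subsetP FD' _ uv; rewrite inE.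
  have := acE c uc (sub_cycle subE cc).
  case: c uc cc => [//|u [|v [|//]]] uc cc _.
    by move: cc; rewrite /= andbT => /subE; rewrite adj_irrefl.
  move: cc; rewrite /= andbT /arc_rel !inE => /andP[/orP[/eqP[-> ->]|uv]].
    by rewrite (negPf yxF) orbF xpair_eqE eq_sym (negPf (adj_neq _ _ xy)).
  case/orP=> [/eqP[vx uy]|vu]; first by rewrite -vx -uy uv in yxF.
  by have := forest_asym _ _ _ FE uv; rewrite vu.
Qed.

(** Following the outgoing arcs from [x], the path cannot come back to itself and
so must stop, at a root. *)
Lemma path_to_root F (x : V) : F \in forestsE ->
  exists p : seq V, [/\ path (arc_rel F) x p, uniq (x :: p)
                      & last x p \in forest_roots F].
Proof.
move=> /forestsP[_ _ acF]; apply: contrapT => noroot.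
have longpath n : exists2 p : seq V,
    path (arc_rel F) x p /\ uniq (x :: p) & size p = n.
  elim: n => [|n [p [xp up] szp]]; first by exists [::].
  have : last x p \notin forest_roots F.
    by apply/negP => lastF; apply: noroot; exists p.
  rewrite inE => /forallPn[v /negPn lastv].
  exists (rcons p v); last by rewrite size_rcons szp.
  rewrite rcons_path xp lastv -rcons_cons rcons_uniq up !andbT; split => //.
  apply/negP => vp.
  suff [s2 uv cv] : exists2 s2, uniq (v :: s2) & cycle (arc_rel F) (v :: s2).
    by have := acF _ uv cv.
  move: vp xp up lastv; rewrite in_cons => /orP[/eqP->|].
    by move=> xp up lastx; exists p => //=; rewrite rcons_path xp.
  case/splitPr => p1 p2; rewrite cat_path last_cat /= => /and3P[_ _ p2p].
  rewrite cat_uniq => /and3P[_ _ /andP[_ /= up2]] lastv.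
  by exists p2 => //=; rewrite rcons_path p2p.
have [p [_ up] szp] := longpath #|V|.
have := max_card (mem (x :: p)); rewrite (card_uniqP up) /= szp.
by rewrite ltnn.
Qed.

(** [x] and [y] can only be connected through the edge between them, as any other
path would close up to a cycle of length at least 3. *)
Lemma same_tree_arc F (x y : V) : F \in forestsE -> adj E x y ->
  same_tree F x y -> (x, y) \in F \/ (y, x) \in F.
Proof.
move=> FE xy /connectP[p0 xp0 lasty]; rewrite lasty in xy *.
case/shortenP: xp0 xy => p xp up _ xy.
have [_ _ acE] := treeE; case: p xp up xy => [|z p] xp up xy.
  by rewrite adj_irrefl in xy.
suff : p = [::] by case: p xp {up xy} => //= /andP[/orP].
have : cycle (adj E) (x :: z :: p).
  rewrite (cycle_path x) [last _ _]/= [path _ _ _]/= adjC xy /=.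
  apply: sub_path xp => u v /orP[|]; first exact: forest_adj.
  by rewrite adjC; exact: forest_adj.
by move/(acE _ up) => /=; rewrite !ltnS leqn0 size_eq0 => /eqP.
Qed.

Context {R : realType}.
Variables (w : {set V} -> R) (q : R).
Hypotheses (q_gt0 : 0 < q).

Local Notation weight := (gibbs_weight (arc_weight w) q).

(** The path from [x] to its root [r] is reversed from its far end: swapping its
last arc [(u, r)] moves the root to [u] and leaves a shorter path. Only arcs of [F]
are reversed, so no arc between [x] and [y] appears. *)
Lemma reroot F (x y : V) : F \in forestsE ->
  (x, y) \notin F -> (y, x) \notin F ->
  exists F', [/\ F' \in forestsE, weight F' = weight F,
                 x \in forest_roots F' & (y, x) \notin F'].
Proof.
move=> FE; have [p [xp up rF]] := path_to_root _ x FE.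
elim/last_ind: p F FE xp up rF => [|p r IHp] F FE xp up rF xyF yxF.
  by exists F.
move: xp; rewrite last_rcons rcons_path in rF * => /andP[xp urF].
set u := last x p in urF *.
have up' : uniq (x :: p) by move: up; rewrite -rcons_cons rcons_uniq => /andP[].
have rp : r \notin x :: p by move: up; rewrite -rcons_cons rcons_uniq => /andP[].
have ur : adj E u r := forest_adj _ _ _ FE urF.
pose F0 := F :\ (u, r).
have F0E : F0 \in forestsE := forest_del _ _ FE.
have F0K : (u, r) |: F0 = F := finset.setD1K urF.
have uF0 : u \in forest_roots F0 := forest_del_root _ _ _ FE urF.
have rF0 : r \in forest_roots F0.
  move: rF; rewrite !inE => /forallP rF; apply/forallP => v.
  by have := rF v; apply: contra; rewrite /arc_rel inE => /andP[].
pose F1 := (r, u) |: F0.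
have F1E : F1 \in forestsE.
  by apply: forest_add; rewrite 1?adjC// !inE eqxx.
have weightF1 : weight F1 = weight F.
  apply: (mulIf (lt0r_neq0 q_gt0)).
  by rewrite -[in RHS]F0K !gibbs_weight_add// /arc_weight /= edgeC.
have inF1 a : a \in F -> a != (u, r) -> a \in F1.
  by move=> aF neq_a; rewrite !inE neq_a aF orbT.
have xpF1 : path (arc_rel F1) x p.
  have rp' : all (predC1 r) p.
    by apply/allP => z zp /=; apply: contraNneq rp => <-; rewrite inE zp orbT.
  elim: (p) {1 2}x xp rp' => //= z s IHs z0 /andP[z0z zs] /andP[zr sr].
  by rewrite IHs// andbT; apply: inF1; rewrite ?xpair_eqE ?negb_and ?zr ?orbT.
have uF1 : u \in forest_roots F1.
  move: uF0; rewrite !inE => /forallP uF0; apply/forallP => v.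
  rewrite /arc_rel in_setU1 xpair_eqE (negPf (adj_neq _ _ ur)) /=; exact: uF0.
have [||F' [F'E weightF' xF' yxF']] := IHp F1 F1E xpF1 up' uF1.
- rewrite !inE negb_or negb_and xyF orbT andbT.
  by apply: contraNneq yxF => -[-> ->].
- rewrite !inE negb_or negb_and yxF orbT andbT.
  by apply: contraNneq xyF => -[-> ->].
by exists F'; split => //; rewrite weightF'.
Qed.

(** * Bounds on the separation probability, and the limits *)

Section EdgeBounds.
Hypothesis w_gt0 : forall e, e \in E -> 0 < w e.
Variables x y : V.
Hypothesis xy : adj E x y.

Let arc_weight_gt0 a : a \in orientations E -> 0 < arc_weight w a.
Proof. by rewrite inE; exact: w_gt0. Qed.

Lemma U_ge0 : 0 <= U E w q x y.
Proof. exact: forest_prob_ge0. Qed.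

Lemma U_le1 : U E w q x y <= 1.
Proof. by rewrite /U /diff_tree_prob forest_probC// gerBl forest_prob_ge0. Qed.

Lemma U_mul_weight_le : U E w q x y * w (edge x y) <= #|{set V * V}|%:R * q.
Proof.
apply: forest_prob_le => //; first exact: w_gt0.
move=> F FE diffF.
have xyF : (x, y) \notin F.
  apply: contra diffF => xyF; apply: connect1.
  by rewrite /arc_rel xyF.
have yxF : (y, x) \notin F.
  apply: contra diffF => yxF; apply: connect1.
  by rewrite /arc_rel yxF orbT.
have [F' [F'E <- xF' yxF']] := reroot _ _ _ FE xyF yxF.
exists ((x, y) |: F'); first exact: forest_add.
by rewrite gibbs_weight_add.
Qed.

Lemma one_minus_U_mul_q_le :
  (1 - U E w q x y) * q <= #|{set V * V}|%:R * w (edge x y).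
Proof.
rewrite /U /diff_tree_prob forest_probC// opprB addrC subrK.
apply: forest_prob_le => //; first exact: w_gt0.
move=> F FE /(same_tree_arc _ _ _ FE xy)[] aF;
  [exists (F :\ (x, y))|exists (F :\ (y, x))]; try exact: forest_del.
- by rewrite -[in LHS](finset.setD1K aF) gibbs_weight_add// forest_del_root.
- rewrite -[in LHS](finset.setD1K aF) gibbs_weight_add ?forest_del_root//.
  by rewrite /arc_weight edgeC.
Qed.

End EdgeBounds.
End TreeForests.

Local Open Scope classical_set_scope.
Local Open Scope ring_scope.

Lemma cvg0_littleo {R : realType} (a b v : nat -> R) (C : R) :
  (forall k, 0 < a k) -> (forall k, 0 < b k) ->
  (forall k, 0 <= v k) -> (forall k, v k * b k <= C * a k) ->
  a =o_\oo b -> v k @[k --> \oo] --> (0 : R).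
Proof.
move=> a0 b0 v0 vb ab; apply/cvgrPdist_le => e e0.
have C1 : 0 < `|C| + 1 by rewrite ltr_wpDl.
have eC0 : 0 < e / (`|C| + 1) by rewrite divr_gt0.
have /eqoP/(_ _ eC0) ab' := ab.
near=> k.
rewrite sub0r normrN ger0_norm// -(ler_pM2r (b0 k)).
apply: le_trans (vb k) _.
have abk : a k <= e / (`|C| + 1) * b k.
  have : `|a k| <= e / (`|C| + 1) * `|b k| by near: k; exact: ab'.
  by rewrite (gtr0_norm (a0 k)) (gtr0_norm (b0 k)).
apply: (@le_trans _ _ ((`|C| + 1) * a k)).
  by rewrite ler_pM2r// (le_trans (ler_norm C))// lerDl.
apply: le_trans (ler_wpM2l (ltW C1) abk) _.
by rewrite mulrA mulrCA divff ?mulr1// gt_eqF.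
Unshelve. all: by end_near.
Qed.

Theorem proposition3 (R : realType) (V : finType) (E : {set {set V}})
    (w : nat -> {set V} -> R) (q : nat -> R) (x y : V)
    (hE : tree E)
    (hw : forall (k : nat) (e : {set V}), e \in E -> 0 < w k e)
    (hq : forall k : nat, 0 < q k)
    (hlim : forall e : {set V}, e \in E ->
      exists l : \bar R,
        (0 <= l)%E /\ (w k e / q k)%:E @[k --> \oo] --> l)
    (hxy : adj E x y) :
  (q =o_\oo (fun k => w k (edge x y)) ->
     U E (w k) (q k) x y @[k --> \oo] --> (0 : R)) /\
  ((fun k => w k (edge x y)) =o_\oo q ->
     U E (w k) (q k) x y @[k --> \oo] --> (1 : R)).
Proof.
have wxy k : 0 < w k (edge x y) by exact: hw.
split=> small.
- apply: cvg0_littleo small => // k; first exact: (U_ge0 _ _ (hq k) (hw k)).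
  exact: (U_mul_weight_le hE _ _ (hq k) (hw k) _ _ hxy).
- have cvg0 : (1 - U E (w k) (q k) x y) @[k --> \oo] --> (0 : R).
    apply: cvg0_littleo small => // k.
      by rewrite subr_ge0 (U_le1 _ _ (hq k) (hw k)).
    exact: (one_minus_U_mul_q_le hE _ _ (hq k) (hw k) _ _ hxy).
  rewrite -[X in _ --> X](subr0 1).
  under eq_fun do rewrite -[U _ _ _ _ _](subKr 1).
  by apply: cvgB cvg0; exact: cvg_cst.
Qed.
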